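(* (a) The formation of product measures $(p,q) \mapsto p \otimes q$ is the only family of maps of sets $$\alpha_{X,Y} : \mathcal{P}X \times \mathcal{P}Y \longrightarrow \mathcal{P}(X \times Y),$$ indexed by all pairs of measurable spaces $X, Y$, which is natural in $X, Y \in \mathsf{Meas}$. That is: the product measure family is natural, and if $(\alpha_{X,Y})$ is any natural family, then $\alpha_{X,Y}(p,q) = p \otimes q$ for all measurable spaces $X, Y$ and all $p \in \mathcal{P}X$, $q \in \mathcal{P}Y$. (b) The analogous statement holds for the distribution functor on sets and on finite sets: the formation of product distributions is the only family of maps $\mathcal{D}X \times \mathcal{D}Y \to \mathcal{D}(X \times Y)$ natural in $X, Y \in \mathsf{Set}$, and it is the only family of maps $\mathcal{D}_{\mathrm{fin}}X \times \mathcal{D}_{\mathrm{fin}}Y \to \mathcal{D}_{\mathrm{fin}}(X \times Y)$ natural in $X, Y \in \mathsf{FinSet}$.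
   Context: $\mathsf{Meas}$ is the category of measurable spaces and measurable maps; $\mathsf{Set}$ and $\mathsf{FinSet}$ are the categories of sets and of finite sets, with functions as morphisms. The Giry functor $\mathcal{P} : \mathsf{Meas} \to \mathsf{Set}$ sends a measurable space $(X,\Sigma_X)$ to the set $\mathcal{P}X$ of all probability measures on it and a measurable map $f : X \to Y$ to the pushforward $f_\ast$, where $(f_\ast p)(S) = p(f^{-1}(S))$ for $S \in \Sigma_Y$. The distribution functor $\mathcal{D} : \mathsf{Set} \to \mathsf{Set}$ sends a set $X$ to the set $\mathcal{D}X$ of finitely supported functions $p : X \to [0,1]$ with $\sum_{x \in X} p(x) = 1$ (also regarded as probability measures on the power set of $X$) and acts on functions by pushforward. $\mathcal{D}_{\mathrm{fin}} : \mathsf{FinSet} \to \mathsf{Set}$ is its restriction to finite sets. For measurable spaces $X$ and $Y$, $X \times Y$ carries the product $\sigma$-algebra $\Sigma_X \otimes \Sigma_Y$, and $p \otimes q$ denotes the product measure, i.e. the unique measure with $(p \otimes q)(S \times T) = p(S)\, q(T)$ for all $S \in \Sigma_X$, $T \in \Sigma_Y$. For $p \in \mathcal{D}X$, $q \in \mathcal{D}Y$, the product distribution is $(p \otimes q)(x,y) = p(x)\,q(y)$. A family $\alpha_{X,Y} : FX \times FY \to F(X \times Y)$ (with $F$ one of $\mathcal{P}, \mathcal{D}, \mathcal{D}_{\mathrm{fin}}$) is natural in $X, Y$ if for all morphisms $f : X \to X'$ and $g : Y \to Y'$ of the relevant category and all $p \in FX$, $q \in FY$, one has $(f \times g)_\ast\,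 \alpha_{X,Y}(p,q) = \alpha_{X',Y'}(f_\ast p, g_\ast q)$. *)

(* Defs.v *)
From HB Require Import structures.
From mathcomp Require Import all_boot all_order all_algebra finmap.
From mathcomp Require Import all_classical all_reals all_analysis giry.

Set Implicit Arguments.
Unset Strict Implicit.
Unset Printing Implicit Defensive.

Import Order.TTheory GRing.Theory Num.Theory.

Local Open Scope classical_set_scope.
Local Open Scope ring_scope.

Definition prod_map (A B C D : Type) (f : A -> C) (g : B -> D) (z : A * B) :
  C * D := (f z.1, g z.2).

Section prod_map_measurable.
Context d1 d2 d3 d4 (X : measurableType d1) (Y : measurableType d2)
  (X' : measurableType d3) (Y' : measurableType d4).
Variables (f : {mfun X >-> X'}) (g : {mfun Y >-> Y'}).

Let measurable_prod_map : measurable_fun [set: X * Y] (prod_map f g).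
Proof. by apply: measurable_fun_pair; exact: measurableT_comp. Qed.

HB.instance Definition _ :=
  isMeasurableFun.Build _ _ _ _ (prod_map f g) measurable_prod_map.
End prod_map_measurable.

(* The objects of Meas are the types [X : measurableType d], over all displays
   [d]. The library requires them to be inhabited; the empty space carries no
   probability measure, hence contributes nothing to a family of maps
   P X * P Y -> P (X * Y).

   An element of [probability X R] is a function on all subsets of [X] whose
   values outside the sigma-algebra are arbitrary. The set P X is therefore
   [probability X R] modulo the relation [≡μ] (equality on measurable sets),
   and a map out of P X is a function on [probability X R] compatible with
   [≡μ]. *)
Section giry.
Variable R : realType.

Definition giry_family :=
  forall (d1 d2 : measure_display) (X : measurableType d1)
    (Y : measurableType d2),
  probability X R -> probability Y R -> probability (X * Y)%type R.

Definition giry_well_defined (alpha : giry_family) :=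
  forall (d1 d2 : measure_display) (X : measurableType d1)
    (Y : measurableType d2) (p p' : probability X R) (q q' : probability Y R),
  p ≡μ p' -> q ≡μ q' -> alpha _ _ X Y p q ≡μ alpha _ _ X Y p' q'.

(* [distribution p f] is the library's pushforward of a probability measure
   [p] along a measurable map [f], with values [p (f @^-1` S)]. *)
Definition giry_natural (alpha : giry_family) :=
  forall (d1 d2 d3 d4 : measure_display)
    (X : measurableType d1) (Y : measurableType d2)
    (X' : measurableType d3) (Y' : measurableType d4)
    (f : {mfun X >-> X'}) (g : {mfun Y >-> Y'})
    (p : probability X R) (q : probability Y R),
  distribution (alpha _ _ X Y p q) (prod_map f g) ≡μ
  alpha _ _ X' Y' (distribution p f) (distribution q g).

Definition giry_product : giry_family :=
  fun _ _ _ _ p q => (p \x q)%E.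

End giry.

Record dist (R : realType) (X : choiceType) := Dist {
  dist_fun :> X -> R ;
  dist_itv : forall x, 0 <= dist_fun x <= 1 ;
  dist_fin : finite_set [set x | dist_fun x != 0] ;
  dist_sum : \sum_(x \in [set: X]) dist_fun x = 1 }.

Section dist_theory.
Variable R : realType.
Implicit Types X Y : choiceType.

Lemma dist_ext X (p q : dist R X) : p =1 q -> p = q.
Proof.
case: p q => [p p1 p2 p3] [q q1 q2 q3] /= /funext pq.
by subst q; congr Dist; exact: Prop_irrelevance.
Qed.

Lemma dist_ge0 X (p : dist R X) x : 0 <= p x.
Proof. by case/andP: (dist_itv p x). Qed.

Lemma sum_supp X (f : X -> R) :
  \sum_(x \in [set x | f x != 0]) f x = \sum_(x \in [set: X]) f x.
Proof.
by apply: fsbig_widen => // x [_ /= /negP]; rewrite negbK => /eqP.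
Qed.

Lemma sum1_itv X (f : X -> R) : (forall x, 0 <= f x) ->
  finite_set [set x | f x != 0] -> \sum_(x \in [set: X]) f x = 1 ->
  forall x, 0 <= f x <= 1.
Proof.
move=> f0 ffin fsum x; rewrite f0 /=.
have [->|fx] := eqVneq (f x) 0; first by rewrite ler01.
rewrite -fsum -sum_supp (fsbigD1 x)//= lerDl.
by apply: fsumr_ge0 => y _.
Qed.

Section pushforward.
Variables (X Y : choiceType) (f : X -> Y) (p : dist R X).

Let pf (y : Y) : R := \sum_(x \in f @^-1` [set y]) p x.

Let pf_ge0 y : 0 <= pf y.
Proof. by apply: fsumr_ge0 => x _; exact: dist_ge0. Qed.

Let pf_supp : [set y | pf y != 0] `<=` f @` [set x | p x != 0].
Proof.
move=> y /=; rewrite /pf => pfy; apply: contrapT => ny.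
move/eqP: pfy; apply; apply: fsbig1 => x /= fxy.
by apply/eqP; apply: contrapT => /negP px; apply: ny; exists x.
Qed.

Let pf_fin : finite_set [set y | pf y != 0].
Proof.
by apply: sub_finite_set pf_supp _; apply: finite_image; exact: dist_fin.
Qed.

Let pf_sum : \sum_(y \in [set: Y]) pf y = 1.
Proof.
pose S := [set x | p x != 0].
have Sfin : finite_set S by exact: dist_fin.
rewrite -(fsbig_widen (f @` S)) //; last first.
  by move=> y [_ /= yS]; apply/eqP; apply: contra_notT yS; exact: pf_supp.
under eq_fsbigr => y _.
  rewrite /pf (_ : \sum_(x \in _) _ =
    \sum_(x \in S) if x \in f @^-1` [set y] then p x else 0); last first.
    rewrite -fsbig_mkcondr setIC; apply/esym/fsbig_widen; first exact: subIsetl.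
    move=> x [/= fxy /not_andP[]// /negP].
    by rewrite negbK => /eqP.
  over.
rewrite exchange_fsbig//; last exact: finite_image.
rewrite -(dist_sum p) -sum_supp; apply: eq_fsbigr => x /set_mem Sx.
rewrite (fsbigD1 (f x))/=; [|exact: finite_image|by exists x].
rewrite ifT ?inE// fsbig1 ?addr0// => y [_ /= yfx].
by rewrite ifF//; apply/negbTE; rewrite notin_setE => /= /esym.
Qed.

Definition dist_map : dist R Y :=
  Dist (sum1_itv pf_ge0 pf_fin pf_sum) pf_fin pf_sum.

End pushforward.

Section product.
Variables (X Y : choiceType) (p : dist R X) (q : dist R Y).

Let pq (z : X * Y) : R := p z.1 * q z.2.

Let pq_ge0 z : 0 <= pq z.
Proof. by rewrite mulr_ge0// dist_ge0. Qed.

Let pq_supp :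
  [set z | pq z != 0] `<=` [set x | p x != 0] `*` [set y | q y != 0].
Proof. by move=> z /=; rewrite mulf_eq0 negb_or => /andP. Qed.

Let pq_fin : finite_set [set z | pq z != 0].
Proof.
by apply: sub_finite_set pq_supp _; apply: finite_setX; exact: dist_fin.
Qed.

Let pq_sum : \sum_(z \in [set: X * Y]) pq z = 1.
Proof.
rewrite -(fsbig_widen ([set x | p x != 0] `*` [set y | q y != 0]))//; last first.
  by move=> z [_ /= zS]; apply/eqP; apply: contra_notT zS; exact: pq_supp.
rewrite -(pair_fsbig _ (fun x y => p x * q y)); [|exact: dist_fin..].
under eq_fsbigr do rewrite -mulr_fsumr sum_supp dist_sum mulr1.
by rewrite sum_supp dist_sum.
Qed.

Definition dist_prod : dist R (X * Y)%type :=
  Dist (sum1_itv pq_ge0 pq_fin pq_sum) pq_fin pq_sum.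

End product.
End dist_theory.

(* The objects of Set are the types [X : choiceType] (classically every type has
   such a structure, and naturality along identity functions makes a family
   independent of it), and those of FinSet the types [X : finType]. *)
Section set_families.
Variable R : realType.

Definition dist_family :=
  forall X Y : choiceType, dist R X -> dist R Y -> dist R (X * Y)%type.

Definition dist_natural (alpha : dist_family) :=
  forall (X Y X' Y' : choiceType) (f : X -> X') (g : Y -> Y')
    (p : dist R X) (q : dist R Y),
  dist_map (prod_map f g) (alpha X Y p q) =
  alpha X' Y' (dist_map f p) (dist_map g q).

Definition dist_product : dist_family := fun _ _ p q => dist_prod p q.

Definition dist_fin_family :=
  forall X Y : finType, dist R X -> dist R Y -> dist R (X * Y)%type.

Definition dist_fin_natural (alpha : dist_fin_family) :=
  forall (X Y X' Y' : finType) (f : X -> X') (g : Y -> Y')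
    (p : dist R X) (q : dist R Y),
  dist_map (prod_map f g) (alpha X Y p q) =
  alpha X' Y' (dist_map f p) (dist_map g q).

Definition dist_fin_product : dist_fin_family := fun _ _ p q => dist_prod p q.

End set_families.

(* Main.v *)
Require Import Defs.
From HB Require Import structures.
From mathcomp Require Import all_boot all_order all_algebra finmap.
From mathcomp Require Import all_classical all_reals all_analysis giry.
From mathcomp Require Import ring lra.

(** Product formation is the only natural family because naturality reduces
    every value of such a family to a function of two real numbers.

    Let alpha be natural and let S, T be measurable sets. Pushing forward along
    the indicators of S and T lands on two-point spaces, where a probability
    measure is the Bernoulli measure given by its mass at [true]. Hence
    alpha(p,q)(S x T) = H (p S) (q T), where H a b is the mass which alpha gives
    to (true, true) on the Bernoulli measures of parameters a and b
    ([giry_rectangle], [dist_rectangle]). One function H serves all spaces, so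
    it can be studied on spaces of one's choice. On a space with disjoint events
    of masses a and a', where a + a' <= 1, finite additivity of alpha(p,q) says
    that H is additive in each argument. Moreover H is nonnegative and H 1 1 = 1,
    because alpha(p,q) has total mass 1. A nonnegative function on [0, 1] which
    is additive as long as sums stay in [0, 1] is linear
    ([additive01_linear]), so H a b = a b ([biadditive01_mul]). Thus alpha(p,q)
    agrees with the product on rectangles, which determine a probability measure
    on the product space.

    The spaces which witness additivity are the unit interval with the uniform
    measure in the case of measurable spaces, and three-point sets in the case
    of finite sets. A natural family on all sets restricts to one on finite
    sets, and its value at (x, y) is read off on the two-point sets obtained
    from the indicators of x and y.

    That products are themselves natural is again checked on rectangles for
    measures, and follows for distributions from distributivity of sums. *)

Set Implicit Arguments.
Unset Strict Implicit.
Unset Printing Implicit Defensive.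

Import Order.TTheory GRing.Theory Num.Theory.

Local Open Scope classical_set_scope.
Local Open Scope ring_scope.

(** * Additive functions on the unit interval *)

Section additive_on_unit_interval.
Variable R : realType.

Definition additive01 (g : R -> R) :=
  forall a b, 0 <= a -> 0 <= b -> a + b <= 1 -> g (a + b) = g a + g b.

(** If e vanishes at 1, then e (1 - a) = - e a; so either a or 1 - a lies in the
    lower half of the interval, where its double is still admissible. This gives
    a point at which |e| is twice as large. Iterating contradicts boundedness
    unless e a = 0. *)
Lemma additive01_bounded_eq0 (e : R -> R) (C : R) : additive01 e -> e 1 = 0 ->
  (forall a, 0 <= a <= 1 -> `|e a| <= C) ->
  forall a, 0 <= a <= 1 -> e a = 0.
Proof.
move=> eD e1 eC.
have double a : 0 <= a <= 1 -> exists2 b, 0 <= b <= 1 & `|e b| = 2 * `|e a|.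
  move=> /andP[a0 a1].
  have half b : 0 <= b <= 2^-1 -> `|e (b + b)| = 2 * `|e b|.
    move=> /andP[b0 b1]; rewrite eD//; last by lra.
    by rewrite -mulr2n normrMn mulr_natl.
  have [ah|ah] := lerP a 2^-1.
    by exists (a + a); [apply/andP; split; lra|apply: half; rewrite a0].
  have eN : e (1 - a) = - e a.
    by apply/eqP; rewrite -addr_eq0 -eD ?subr_ge0// ?subrK// e1.
  exists (1 - a + (1 - a)); first by apply/andP; split; lra.
  by rewrite half ?eN ?normrN//; apply/andP; split; lra.
have iterate n a : 0 <= a <= 1 ->
    exists2 b, 0 <= b <= 1 & `|e b| = (2 ^ n)%:R * `|e a|.
  move=> a01; elim: n => [|n [b b01 eb]]; first by exists a; rewrite ?mul1r.
  by have [c c01 ec] := double b b01; exists c; rewrite // ec eb expnS natrM mulrA.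
move=> a a01; apply/eqP; apply: contraT; rewrite -normr_gt0 => ea0.
have [b b01 eb] := iterate (Num.bound (C / `|e a|)) a a01.
have := eC b b01; rewrite eb leNgt => /negP[].
rewrite -ltr_pdivrMr//.
have C0 : 0 <= C by apply: le_trans (eC a a01); exact: normr_ge0.
apply: (lt_le_trans (archi_boundP _)); first by rewrite divr_ge0.
by rewrite ler_nat ltnW// ltn_expl.
Qed.

(** Nonnegativity makes g monotone, hence bounded by g 1, and so bounds the
    deviation of g from the linear function with the same value at 1. *)
Lemma additive01_linear (g : R -> R) : additive01 g ->
  (forall a, 0 <= a <= 1 -> 0 <= g a) ->
  forall a, 0 <= a <= 1 -> g a = a * g 1.
Proof.
move=> gD g0.
have g_le a : 0 <= a <= 1 -> g a <= g 1.
  move=> /andP[a0 a1]; rewrite -(subrK a 1) gD ?subr_ge0// ?subrK//.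
  by rewrite lerDr g0//; apply/andP; split; lra.
move=> a a01; apply/eqP; rewrite -subr_eq0; apply/eqP.
pose e x := g x - x * g 1.
apply: (@additive01_bounded_eq0 e (g 1)) a01.
- by move=> x y x0 y0 xy1; rewrite /e gD//; ring.
- by rewrite /e mul1r subrr.
- move=> x x01; rewrite /e ler_norml.
  have := g0 x x01; have := g_le x x01; have g1 := g0 1 _.
  case/andP: x01 => x0 x1 gx1 gx0.
  have {}g1 : 0 <= g 1 by apply: g1; rewrite ler01 lexx.
  by apply/andP; split; nra.
Qed.

Lemma biadditive01_mul (H : R -> R -> R) :
  (forall b : R, 0 <= b <= 1 -> additive01 (H^~ b)) ->
  (forall a : R, 0 <= a <= 1 -> additive01 (H a)) ->
  (forall a b : R, 0 <= a <= 1 -> 0 <= b <= 1 -> 0 <= H a b) ->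
  H 1 1 = 1 ->
  forall a b : R, 0 <= a <= 1 -> 0 <= b <= 1 -> H a b = a * b.
Proof.
move=> HDl HDr H0 H11 a b a01 b01.
have one01 : 0 <= (1 : R) <= 1 by rewrite ler01 lexx.
rewrite (additive01_linear (HDl b b01)) => [|x x01|//]; last exact: H0.
by rewrite (additive01_linear (HDr 1 one01)) ?H11 ?mulr1// => x x01; exact: H0.
Qed.

End additive_on_unit_interval.

(** * Products of probability measures *)

Section giry_product_natural.
Variable R : realType.

(** Rectangles are closed under intersection and generate the product
    sigma-algebra. *)
Lemma giry_productP d1 d2 (X : measurableType d1) (Y : measurableType d2)
    (p : probability X R) (q : probability Y R)
    (r : probability (X * Y)%type R) :
  (forall S T, measurable S -> measurable T -> r (S `*` T) = (p S * q T)%E) ->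
  r ≡μ (p \x q)%E.
Proof. by move=> rpq U mU; apply/esym/product_measure_unique. Qed.

Lemma giry_product_well_defined : giry_well_defined (@giry_product R).
Proof.
move=> d1 d2 X Y p p' q q' pp' qq'; apply: giry_productP => S T mS mT.
by rewrite /giry_product/= product_measure1E// pp'// qq'.
Qed.

Lemma giry_product_natural : giry_natural (@giry_product R).
Proof.
move=> d1 d2 d3 d4 X Y X' Y' f g p q; apply: giry_productP => S T mS mT.
rewrite /= /distribution /pushforward.
rewrite (_ : _ @^-1` _ = (f @^-1` S) `*` (g @^-1` T))//.
by rewrite /giry_product/= product_measure1E//;
   rewrite -[X in measurable X]setTI; exact: measurable_funPT.
Qed.

End giry_product_natural.

(** * Uniqueness for measurable spaces *)

Section uniform01.
Variable R : realType.

Definition uniform01 : probability (measurableTypeR R) R :=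
  uniform_prob (@ltr01 R).

Lemma uniform01_itvco (a b : R) : 0 <= a -> a <= b -> b <= 1 ->
  uniform01 `[a, b[%classic = (b - a)%:E.
Proof.
move=> a0 ab b1; rewrite /uniform01/= /uniform_prob integral_uniform_pdf.
rewrite setIidl; last first.
  by move=> x /=; rewrite !in_itv/= => /andP[ax xb]; apply/andP; split; lra.
rewrite (eq_integral (fun=> 1%E)); last first.
  move=> x; rewrite inE/= in_itv/= /uniform_pdf => /andP[ax xb].
  by rewrite ifT ?subr0 ?invr1//; apply/andP; split; lra.
rewrite integral_cst//= mul1e lebesgue_measure_itv/= lte_fin.
case: ltP => [_|ba]; first by rewrite EFinB.
by rewrite (le_anti (introT andP (conj ab ba))) subrr.
Qed.

End uniform01.

Lemma setXUl (S T : Type) (A B : set S) (C : set T) :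
  (A `|` B) `*` C = A `*` C `|` B `*` C.
Proof. by rewrite predeqE => -[x y]; split=> /=; tauto. Qed.

Lemma setXUr (S T : Type) (A B : set T) (C : set S) :
  C `*` (A `|` B) = C `*` A `|` C `*` B.
Proof. by rewrite predeqE => -[x y]; split=> /=; tauto. Qed.

Section giry_unique.
Variables (R : realType) (alpha : giry_family R).
Hypotheses (alpha_wd : giry_well_defined alpha) (alpha_nat : giry_natural alpha).

(** This is total in both parameters: outside [0, 1], [bernoulli_prob] is the
    Dirac measure at [false]. *)
Definition giry_table (a b : R) : R :=
  fine (alpha (bernoulli_prob a : probability _ _)
              (bernoulli_prob b : probability _ _) [set (true, true)]).

(** The mass of [S] alone determines the pushforward along its indicator. With
    [giry_well_defined], the value of a family on two such pushforwards therefore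
    depends only on the masses of the two events. *)
Lemma distribution_indic_bernoulli d (X : measurableType d)
    (p : probability X R) (S : set X) (f : {mfun X >-> bool}) :
  f @^-1` [set true] = S -> distribution p f ≡μ bernoulli_prob (fine (p S)).
Proof.
move=> fS U mU; apply: eq_bernoulli.
by rewrite /= /distribution /pushforward fS fineK// fin_num_measure// -fS
  -[X in measurable X]setTI; exact: measurable_funPT.
Qed.

(** A rectangle is the preimage of (true, true) under the pair of indicators, so
    naturality transports its mass to the table. *)
Lemma giry_rectangle d1 d2 (X : measurableType d1) (Y : measurableType d2)
    (p : probability X R) (q : probability Y R) S T :
  measurable S -> measurable T ->
  alpha p q (S `*` T) = (giry_table (fine (p S)) (fine (q T)))%:E.
Proof.
have indic d (Z : measurableType d) (U : set Z) : measurable U ->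
    exists f : {mfun Z >-> bool}, f @^-1` [set true] = U.
  move=> mU.
  have mf : measurable_fun [set: Z] (fun z => z \in U).
    by apply: (measurable_fun_bool true); rewrite setTI preimage_mem_true.
  pose fM := isMeasurableFun.Build _ _ _ _ _ mf.
  pose f : {mfun Z >-> bool} := HB.pack (fun z => z \in U) fM.
  by exists f; exact: preimage_mem_true.
move=> /indic[f fS] /indic[g gT].
have mTT : measurable [set (true, true)].
  rewrite (_ : [set _] = [set true] `*` [set true]); first exact: measurableX.
  by apply/seteqP; split=> -[x y] /= [-> ->].
rewrite /giry_table fineK ?fin_num_measure//.
transitivity (alpha (distribution p f) (distribution q g) [set (true, true)]).
  rewrite -alpha_nat// /distribution /pushforward; congr (alpha p q _).
  rewrite -fS -gT; apply/seteqP; split=> -[x y] /=; rewrite /prod_map/=.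
    by move=> [-> ->].
  by move=> [-> ->].
by apply: alpha_wd => //; exact: distribution_indic_bernoulli.
Qed.

Lemma giry_table_uniform (a a' b b' : R) :
  0 <= a -> a <= a' -> a' <= 1 -> 0 <= b -> b <= b' -> b' <= 1 ->
  alpha (uniform01 R) (uniform01 R) (`[a, a'[ `*` `[b, b'[) =
  (giry_table (a' - a) (b' - b))%:E.
Proof. by move=> *; rewrite giry_rectangle// !uniform01_itvco. Qed.

(** Adjacent intervals under the uniform measure realize any two masses with sum
    at most 1 as disjoint events; additivity of the measure
    [alpha (uniform01 R) (uniform01 R)] then gives additivity of the table in
    each argument. *)
Lemma giry_tableE (a b : R) : 0 <= a <= 1 -> 0 <= b <= 1 ->
  giry_table a b = a * b.
Proof.
have itvU (x y : R) : 0 <= x -> 0 <= y ->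
    `[0, x + y[%classic = `[0, x[ `|` `[x, x + y[.
  move=> x0 y0; apply/seteqP; split=> z /=; rewrite !in_itv/=.
    by move=> /andP[z0 zxy]; case: (ltP z x) => zx; [left|right]; rewrite ?z0.
  by move=> [|] /andP[z0 z1]; apply/andP; split; lra.
have itvI (x y : R) : `[0, x[ `&` `[x, x + y[ = set0 :> set R.
  by apply/seteqP; split=> z //=; rewrite !in_itv/= => -[/andP[? ?] /andP[? ?]]; lra.
apply: biadditive01_mul.
- move=> {}b /andP[b0 b1] x y x0 y0 xy1; apply: EFin_inj.
  have := @giry_table_uniform 0 (x + y) 0 b; rewrite !subr0 => <-//; last lra.
  rewrite itvU// setXUl measureU//=.
  + rewrite !giry_table_uniform//; [|lra..].
    by rewrite !subr0 [x + y]addrC addrK -EFinD.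
  + exact: measurableX.
  + exact: measurableX.
  + by rewrite -setXI setIid itvI set0X.
- move=> {}a /andP[a0 a1] x y x0 y0 xy1; apply: EFin_inj.
  have := @giry_table_uniform 0 a 0 (x + y); rewrite !subr0 => <-//; last lra.
  rewrite itvU// setXUr measureU//=.
  + rewrite !giry_table_uniform//; [|lra..].
    by rewrite !subr0 [x + y]addrC addrK -EFinD.
  + exact: measurableX.
  + exact: measurableX.
  + by rewrite -setXI setIid itvI setX0.
- by move=> x y _ _; rewrite fine_ge0.
- apply: EFin_inj.
  have <- : alpha (uniform01 R) (uniform01 R) (setT `*` setT) =
      (giry_table 1 1)%:E.
    by rewrite giry_rectangle// probability_setT.
  by rewrite setXTT probability_setT.
Qed.

Lemma giry_natural_unique d1 d2 (X : measurableType d1) (Y : measurableType d2)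
    (p : probability X R) (q : probability Y R) :
  alpha p q ≡μ (p \x q)%E.
Proof.
apply: giry_productP => S T mS mT.
have p01 d (Z : measurableType d) (m : probability Z R) U : measurable U ->
    0 <= fine (m U) <= 1.
  move=> mU; rewrite fine_ge0//= -lee_fin fineK ?fin_num_measure//.
  exact: probability_le1.
by rewrite giry_rectangle// giry_tableE ?p01// EFinM !fineK ?fin_num_measure.
Qed.

End giry_unique.

(** * Products of finitely supported distributions *)

Section dist_product_natural.
Variable R : realType.
Implicit Types X Y : choiceType.

(** The sets may be infinite, so both sides are first cut down to the finite
    supports, where the double sum can be rearranged. *)
Lemma sum_dist_setX X Y (p : dist R X) (q : dist R Y) (A : set X) (B : set Y) :
  \sum_(z \in A `*` B) p z.1 * q z.2 =
  (\sum_(x \in A) p x) * (\sum_(y \in B) q y).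
Proof.
pose supp Z (r : dist R Z) := [set z | r z != 0].
have restrict Z (r : dist R Z) (C : set Z) :
    \sum_(z \in C) r z = \sum_(z \in C `&` supp Z r) r z.
  apply/esym/fsbig_widen => [|z [Cz /= /not_andP[//|/negP]]]; first exact: subIsetl.
  by rewrite negbK => /eqP.
have fin Z (r : dist R Z) (C : set Z) : finite_set (C `&` supp Z r).
  by apply: finite_setIr; exact: dist_fin.
rewrite (restrict _ p) (restrict _ q) mulr_fsuml.
under [RHS]eq_fsbigr do rewrite mulr_fsumr.
rewrite (pair_fsbig _ (fun x y => p x * q y))// setXI.
apply/esym/fsbig_widen => [|[x y] /= [[Ax By] nxy]]; first exact: subIsetl.
apply/eqP; rewrite mulf_eq0; apply: contra_notT nxy.
by rewrite negb_or => /andP[px qy].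
Qed.

Lemma dist_product_map X Y X' Y' (f : X -> X') (g : Y -> Y')
    (p : dist R X) (q : dist R Y) :
  dist_map (prod_map f g) (dist_prod p q) =
  dist_prod (dist_map f p) (dist_map g q).
Proof.
apply: dist_ext => -[x y] /=; rewrite -sum_dist_setX.
by apply: eq_fsbigl; apply/seteqP; split=> -[u v] /=; rewrite /prod_map/= => -[-> ->].
Qed.

Lemma dist_map_singleton X (p : dist R X) x :
  dist_map (eq_op^~ x) p true = p x.
Proof.
transitivity (\sum_(y \in [set x]) p y); last exact: fsbig_set1.
by apply: eq_fsbigl; apply/seteqP; split=> y /= /eqP.
Qed.

Lemma dist_map_pair_singleton X Y (r : dist R (X * Y)%type) x y :
  dist_map (prod_map (eq_op^~ x) (eq_op^~ y)) r (true, true) = r (x, y).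
Proof.
transitivity (\sum_(z \in [set (x, y)]) r z); last exact: fsbig_set1.
apply: eq_fsbigl; apply/seteqP; split=> -[u v] /=; rewrite /prod_map/=.
  by move=> [/eqP-> /eqP->].
by move=> [-> ->]; rewrite !eqxx.
Qed.

End dist_product_natural.

(** * Uniqueness for finite sets *)

Section finite_dist.
Variable R : realType.
Implicit Types X Y : finType.

Lemma sum_setT X (f : X -> R) : \sum_(x \in [set: X]) f x = \sum_x f x.
Proof.
rewrite (@bigfs _ _ _ _ (index_enum X) xpredT f) ?index_enum_uniq//.
  by apply: eq_fsbigl; apply/seteqP; split.
by move=> i _; rewrite mem_index_enum.
Qed.

Lemma dist_map_finE X (Y : choiceType) (f : X -> Y) (p : dist R X) y :
  dist_map f p y = \sum_(x | f x == y) p x.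
Proof.
rewrite /= fsbig_mkcond sum_setT [RHS]big_mkcond/=; apply: eq_bigr => x _.
congr (if _ then _ else _).
by apply/idP/idP; rewrite inE/= => /eqP.
Qed.

Section mk_dist.
Variables (X : finType) (f : X -> R).
Hypotheses (f0 : forall x, 0 <= f x) (f1 : \sum_x f x = 1).

Let f_fin : finite_set [set x | f x != 0].
Proof. exact: finite_finset. Qed.

Let f_sum : \sum_(x \in [set: X]) f x = 1.
Proof. by rewrite sum_setT. Qed.

Definition mk_dist : dist R X := Dist (sum1_itv f0 f_fin f_sum) f_fin f_sum.

End mk_dist.

Lemma bernoulli_clamp_ge0 (a : R) b :
  0 <= bernoulli_pmf (if 0 <= a <= 1 then a else 0) b.
Proof. by apply: bernoulli_pmf_ge0; case: ifPn => // _; rewrite lexx ler01. Qed.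

Lemma bernoulli_pmf_sum (a : R) : \sum_b bernoulli_pmf a b = 1.
Proof. by rewrite big_bool/= subrKC. Qed.

(** Parameters outside [0, 1] are sent to 0, so that the Bernoulli distribution
    is a total function of its parameter. *)
Definition bernoulli_dist (a : R) : dist R bool :=
  mk_dist (bernoulli_clamp_ge0 a) (bernoulli_pmf_sum _).

Lemma dist_bool (p : dist R bool) : p = bernoulli_dist (p true).
Proof.
apply: dist_ext => b; rewrite /= dist_itv /bernoulli_pmf; case: b => //.
by have := dist_sum p; rewrite sum_setT big_bool/= => <-; ring.
Qed.

(** A three-point set carries two disjoint events of prescribed masses, with
    [None] absorbing the remaining mass; this is what additivity of the table in
    one argument is tested on. *)
Lemma dist_split (a b : R) : 0 <= a -> 0 <= b -> a + b <= 1 ->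
  exists p : dist R (option bool),
    p (Some true) = a /\ p (Some false) = b.
Proof.
move=> a0 b0 ab1.
pose f o := if o is Some c then if c then a else b else 1 - (a + b).
have f0 o : 0 <= f o by case: o => [[]|]//=; rewrite subr_ge0.
have f1 : \sum_o f o = 1.
  rewrite (bigD1 None)//= (bigD1 (Some true))//= (bigD1 (Some false))//=.
  by rewrite big1 ?addr0 ?subrK// => -[[]|].
by exists (mk_dist f0 f1).
Qed.

End finite_dist.

Section dist_fin_unique.
Variables (R : realType) (alpha : dist_fin_family R).
Hypothesis alpha_nat : dist_fin_natural alpha.

Definition dist_table (a b : R) : R :=
  alpha (bernoulli_dist a) (bernoulli_dist b) (true, true).

(** The events are boolean predicates [s] and [t], which are their own indicator
    maps to [bool]. *)
Lemma dist_rectangle (X Y : finType) (p : dist R X) (q : dist R Y)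
    (s : X -> bool) (t : Y -> bool) :
  \sum_(z | s z.1 && t z.2) alpha p q z =
  dist_table (\sum_(x | s x) p x) (\sum_(y | t y) q y).
Proof.
have pushE (Z : finType) (r : dist R Z) (u : Z -> bool) :
    dist_map u r = bernoulli_dist (\sum_(z | u z) r z).
  by rewrite [LHS]dist_bool dist_map_finE; under eq_bigl do rewrite eqb_id.
rewrite /dist_table -!pushE -alpha_nat dist_map_finE.
by apply: eq_bigl => z; rewrite xpair_eqE !eqb_id.
Qed.

Let sum_point (Z : finType) (r : dist R Z) z : \sum_(w | w == z) r w = r z.
Proof. exact: big_pred1_eq. Qed.

Lemma dist_tableE (a b : R) : 0 <= a <= 1 -> 0 <= b <= 1 ->
  dist_table a b = a * b.
Proof.
have someE (p : dist R (option bool)) :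
    \sum_(o | o != None) p o = p (Some true) + p (Some false).
  rewrite (bigD1 (Some true))//= (bigD1 (Some false))//= big1 ?addr0//.
  by case=> [[]|].
have trueE (c : R) : 0 <= c <= 1 -> \sum_(x | x) bernoulli_dist c x = c.
  by move=> c01; rewrite big_mkcond big_bool/= addr0 c01.
apply: biadditive01_mul.
- move=> {}b b01 x y x0 y0 xy1.
  have [p [<- <-]] := dist_split x0 y0 xy1.
  (* the event o != None is split according to whether o = Some true *)
  have split2 := bigID (fun z : option bool * bool => z.1 == Some true).
  rewrite -someE -{1 2 3}(trueE b b01) -dist_rectangle split2.
  rewrite -(sum_point p (Some true)) -(sum_point p (Some false)).
  rewrite -!dist_rectangle.
  by congr (_ + _); apply: eq_bigl => -[[[]|] []].
- move=> {}a a01 x y x0 y0 xy1.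
  have [p [<- <-]] := dist_split x0 y0 xy1.
  have split2 := bigID (fun z : bool * option bool => z.2 == Some true).
  rewrite -someE -{1 2 3}(trueE a a01) -dist_rectangle split2.
  rewrite -(sum_point p (Some true)) -(sum_point p (Some false)).
  rewrite -!dist_rectangle.
  by congr (_ + _); apply: eq_bigl => -[[] [[]|]].
- by move=> x y _ _; exact: dist_ge0.
- have total (Z : finType) (r : dist R Z) : \sum_z r z = 1.
    by rewrite -sum_setT dist_sum.
  have := dist_rectangle (bernoulli_dist 1) (bernoulli_dist 1) xpredT xpredT.
  by rewrite !total => <-.
Qed.

Lemma dist_fin_natural_unique (X Y : finType) (p : dist R X) (q : dist R Y) :
  alpha p q = dist_prod p q.
Proof.
apply: dist_ext => -[x y]; rewrite [RHS]/=.
rewrite -dist_tableE ?dist_itv//.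
rewrite -(sum_point p x) -(sum_point q y).
rewrite -dist_rectangle -(sum_point (alpha p q)).
by apply: eq_bigl => z; rewrite /= -xpair_eqE -surjective_pairing.
Qed.

End dist_fin_unique.

(** * Uniqueness for sets *)

(** The event that a pair equals (x, y) is a rectangle of singletons, so only
    the value of the family on [bool] matters, and [bool] is finite. *)
Lemma dist_natural_unique (R : realType) (alpha : dist_family R) :
  dist_natural alpha ->
  forall (X Y : choiceType) (p : dist R X) (q : dist R Y),
    alpha X Y p q = dist_prod p q.
Proof.
move=> alpha_nat X Y p q; apply: dist_ext => -[x y].
pose alpha_fin : dist_fin_family R := fun X Y p q => alpha X Y p q.
have alpha_fin_nat : dist_fin_natural alpha_fin.
  by move=> *; exact: alpha_nat.
rewrite -dist_map_pair_singleton alpha_nat.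
rewrite [alpha _ _ _ _](dist_fin_natural_unique alpha_fin_nat).
by congr (_ * _); exact: dist_map_singleton.
Qed.

(** * Uniqueness of products *)

Theorem theorem3p1 (R : realType) :
  [/\ giry_well_defined (@giry_product R),
      giry_natural (@giry_product R) &
      forall alpha : giry_family R,
        giry_well_defined alpha -> giry_natural alpha ->
        forall (d1 d2 : measure_display) (X : measurableType d1)
          (Y : measurableType d2) (p : probability X R) (q : probability Y R),
          alpha _ _ X Y p q ≡μ (p \x q)%E]
  /\
  [/\ dist_natural (@dist_product R) &
      forall alpha : dist_family R, dist_natural alpha ->
        forall (X Y : choiceType) (p : dist R X) (q : dist R Y),
          alpha X Y p q = dist_prod p q]
  /\
  [/\ dist_fin_natural (@dist_fin_product R) &
      forall alpha : dist_fin_family R, dist_fin_natural alpha ->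
        forall (X Y : finType) (p : dist R X) (q : dist R Y),
          alpha X Y p q = dist_prod p q].
Proof.
split; [split|split; split].
- exact: giry_product_well_defined.
- exact: giry_product_natural.
- by move=> alpha wd nat d1 d2 X Y p q; exact: giry_natural_unique.
- by move=> X Y X' Y' f g p q; exact: dist_product_map.
- by move=> alpha nat X Y p q; exact: dist_natural_unique.
- by move=> X Y X' Y' f g p q; exact: dist_product_map.
- by move=> alpha nat X Y p q; exact: dist_fin_natural_unique.
Qed.
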